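(* Let $a_1,\ldots,a_k\in L_c\cup O_c$ and $b_1,\ldots,b_k\in R_c\cup O_c$ be such that $a_i\neq b_j$ for all $i,j$ and $P=\{a_1,b_1\}\{a_2,b_2\}\cdots\{a_k,b_k\}$ is a partition of a subset of $S_c$ into the $k$ two-element parts $\{a_i,b_i\}$. Then the number of equivalence classes of $S_n$ under the $P$-equivalence is $$\sum_{j\ge0,\ cj\le n}\frac{(-1)^j\,((n-cj+j)!)^2\,k^j}{j!\,(n-cj)!}.$$
   Context: Fix positive integers $c\le n$. $S_m$ is the set of permutations of $\{1,\dots,m\}$ written as words. A word $w_1\cdots w_c$ (distinct integer letters) forms $u\in S_c$ if there is an integer $k$ with $w_i=u_i+k$ for all $i$. A hit in $w\in S_n$ is a contiguous subword of length $c$ forming some $u\in S_c$. For a partition $P$ of a subset of $S_c$, a $P$-hit is a hit forming a permutation in some part of $P$; a $P$-rearrangement rearranges the letters of a $P$-hit in place so that the new subword forms a permutation in the same part of $P$. The $P$-equivalence on $S_n$ is the reflexive-transitive closure of $P$-rearrangement. Tail size of a word $w$ of length $m$ with distinct letters: least $k\ge1$ such that the first $k$ letters are the $k$ smallest letters of $w$. $w$ is right leaning if its tail size is $<m$, left leaning if its reversal has tail size $<m$, omni leaning if neither. $R_c,L_c,O_c$: the right, left, omni leaning permutations in $S_c$. *)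

(* Defs.v *)
From mathcomp Require Import all_boot all_order all_algebra all_fingroup.
From mathcomp Require Import boolp.

Set Implicit Arguments.
Unset Strict Implicit.
Unset Printing Implicit Defensive.

Import Order.TTheory GRing.Theory Num.Theory.
Local Open Scope ring_scope.

(* One-line notation. The underlying permutation acts on {0, ..., m-1},
   so letters are shifted to range over {1, ..., m}. *)
Definition word m (s : 'S_m) : seq int :=
  [seq Posz (s i).+1 | i <- enum 'I_m].

Definition forms c (w : seq int) (u : 'S_c) : Prop :=
  exists k : int, w = [seq x + k | x <- word u].

Definition P_rearrangement c n (P : {set {set 'S_c}}) (w w' : 'S_n) : Prop :=
  exists A : {set 'S_c}, A \in P /\
  exists u v : 'S_c, [/\ u \in A, v \in A &
  exists x s s' y : seq int,
    [/\ word w = x ++ s ++ y, word w' = x ++ s' ++ y, perm_eq s' s,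
        forms s u & forms s' v]].

Definition P_equiv c n (P : {set {set 'S_c}}) : rel 'S_n :=
  connect (fun w w' => `[< P_rearrangement P w w' >]).

Definition P_classes c n (P : {set {set 'S_c}}) : {set {set 'S_n}} :=
  equivalence_partition (P_equiv P) [set: 'S_n].

Definition smallest_first (w : seq int) (k : nat) : bool :=
  perm_eq (take k w) (take k (sort <=%R w)).

Lemma smallest_first_ex (w : seq int) :
  exists k, (0 < k)%N && smallest_first w k.
Proof.
exists (size w).+1; rewrite /smallest_first !take_oversize ?size_sort ?leqnSn //.
by rewrite perm_sym perm_sort perm_refl.
Qed.

Definition tail_size (w : seq int) : nat := ex_minn (smallest_first_ex w).

Definition right_leaning (w : seq int) : bool := (tail_size w < size w)%N.
Definition left_leaning (w : seq int) : bool := (tail_size (rev w) < size w)%N.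
Definition omni_leaning (w : seq int) : bool :=
  ~~ right_leaning w && ~~ left_leaning w.

Definition R_ c : {set 'S_c} := [set u | right_leaning (word u)].
Definition L_ c : {set 'S_c} := [set u | left_leaning (word u)].
Definition O_ c : {set 'S_c} := [set u | omni_leaning (word u)].

(* Main.v *)
(* Call a hit by its starting position, and a flip at [q] the exchange of [a_i] and
   [b_i] in a hit at [q]. Two overlapping hits are either both in R, with values and
   positions shifted the same way, or both in L, with opposite shifts; so an
   [a]-hit never overlaps a [b]-hit. Consequently, if a hit at [p] is destroyed by
   flipping an overlapping [q < p], then no hit meets the window of [q] until [q] is
   flipped back. Hence an equivalence class for the flips starting before [p]
   contains hits at [p] of at most one pattern, and these words form one class for the
   flips disjoint from [p]. Allowing flips at [p] therefore merges classes in
   disjoint pairs, one for each [i] and each class of the words obtained by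
   contracting a [b_i] at [p] to a letter. The number f(n, p) of classes of S_n for
   the flips starting before [p] thus satisfies
     f(n, p + 1) = f(n, p) - k f(n - c + 1, p + 1 - c),   f(n, 0) = n!,
   and the theorem is the solution of this recursion at p = n - c + 1. *)
Require Import Defs.
From mathcomp Require Import all_boot all_order all_algebra all_fingroup.
From mathcomp Require Import boolp zify ring.

Set Implicit Arguments.
Unset Strict Implicit.
Unset Printing Implicit Defensive.

Import Order.TTheory GRing.Theory Num.Theory.
Local Open Scope nat_scope.

(** * Permutations as functions on natural numbers, counted from 0 *)

Definition letter n (w : 'S_n) (x : nat) : nat :=
  if insub x is Some i then val (w i) else x.

Section Letters.
Variable n : nat.
Implicit Types w : 'S_n.

Lemma letterE w (i : 'I_n) : letter w i = w i.
Proof. by rewrite /letter valK. Qed.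

Lemma letter_lt w x : x < n -> letter w x < n.
Proof. by move=> ltx; rewrite (letterE w (Ordinal ltx)). Qed.

Lemma letter_inj w x y : x < n -> y < n -> letter w x = letter w y -> x = y.
Proof.
move=> ltx lty; rewrite (letterE w (Ordinal ltx)) (letterE w (Ordinal lty)).
by move=> /val_inj/perm_inj[].
Qed.

Lemma letter_surj w y : y < n -> exists2 x, x < n & letter w x = y.
Proof.
by move=> lty; exists ((w^-1)%g (Ordinal lty)); rewrite // letterE permKV.
Qed.

Lemma letter_ext w w' : (forall x, x < n -> letter w x = letter w' x) -> w = w'.
Proof.
by move=> eqww'; apply/permP=> i; apply: val_inj; rewrite /= -!letterE eqww'.
Qed.

Lemma perm_of_letters (f : nat -> nat) :
    (forall x, x < n -> f x < n) ->
    (forall x y, x < n -> y < n -> f x = f y -> x = y) ->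
  exists w, forall x, x < n -> letter w x = f x.
Proof.
move=> ltf injf; pose g (i : 'I_n) := Ordinal (ltf i (ltn_ord i)).
have injg : injective g by move=> i j /(congr1 val)/injf/val_inj; apply.
by exists (perm injg) => x ltx; rewrite (letterE _ (Ordinal ltx)) permE.
Qed.

Lemma card_letter w (A : pred nat) :
  #|[set x : 'I_n | A (letter w x)]| = #|[set y : 'I_n | A y]|.
Proof.
rewrite -(card_preimset [set y : 'I_n | A y] (@perm_inj _ w)).
by apply: eq_card => x; rewrite !inE letterE.
Qed.

Lemma card_ord_interval lo hi :
  hi <= n -> #|[set x : 'I_n | lo <= x < hi]| = hi - lo.
Proof.
move=> lehi; rewrite -sum1dep_card -(big_mkord (fun x => lo <= x < hi) (fun=> 1)).
transitivity (\sum_(lo <= x < hi) 1); last by rewrite sum_nat_const_nat muln1.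
rewrite (big_nat_widen lo _ _ _ _ lehi) (big_nat_widenl lo 0) //.
by apply: eq_bigl => x; rewrite andTb andbC.
Qed.

End Letters.

(** The pairs [(g x, g' y)] with [r x y] form the graph of a bijection between the two images. A
    relation suits class counts, where representatives are found only up to equivalence. *)
Lemma card_imset_rel (T T' A B : finType) (S : {set T}) (S' : {set T'})
    (r : T -> T' -> Prop) (g : T -> A) (g' : T' -> B) :
    (forall x, x \in S -> exists2 y, y \in S' & r x y) ->
    (forall y, y \in S' -> exists2 x, x \in S & r x y) ->
    (forall x y x' y', x \in S -> x' \in S -> r x y -> r x' y' ->
      (g x == g x') = (g' y == g' y')) ->
  #|g @: S| = #|g' @: S'|.
Proof.
move=> totl totr compat.
pose R z := exists x y, [/\ x \in S, y \in S', r x y & z = (g x, g' y)].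
pose Z := [set z | `[< R z >]].
have -> : g @: S = fst @: Z.
  apply/setP=> a; apply/imsetP/imsetP=> [[x xS ->]|[z]].
    have [y yS rxy] := totl x xS; exists (g x, g' y) => //.
    by rewrite inE; apply/asboolP; exists x, y.
  by rewrite inE => /asboolP[x [y [xS yS rxy ->]]] ->; exists x.
have -> : g' @: S' = snd @: Z.
  apply/setP=> a; apply/imsetP/imsetP=> [[y yS ->]|[z]].
    have [x xS rxy] := totr y yS; exists (g x, g' y) => //.
    by rewrite inE; apply/asboolP; exists x, y.
  by rewrite inE => /asboolP[x [y [xS yS rxy ->]]] ->; exists y.
rewrite !card_in_imset // => z z'; rewrite !inE.
  move=> /asboolP[x [y [xS yS rxy ->]]] /asboolP[x' [y' [xS' yS' rxy' ->]]] /= e.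
  by congr (_, _) => //; apply/eqP; rewrite (compat x y x' y') // e.
move=> /asboolP[x [y [xS yS rxy ->]]] /asboolP[x' [y' [xS' yS' rxy' ->]]] /= e.
by congr (_, _) => //; apply/eqP; rewrite -(compat x y x' y') // e.
Qed.

Ltac lia_ifs := repeat (case: ifP => ?); lia.

(** * Hits, overlaps and flips *)

Section Hits.
(* [pat false i] and [pat true i] stand for [a_i] and [b_i]. *)
Variables (c k : nat) (pat : bool -> 'I_k -> 'S_c).
Hypothesis c_gt0 : 0 < c.
Hypothesis pat_inj : forall s i s' i', pat s i = pat s' i' -> s = s' /\ i = i'.

Definition Rdec (u : 'S_c) d := forall j, j < c -> (j < d) = (letter u j < d).
Definition Ldec (u : 'S_c) d := forall j, j < c -> (d <= j) = (letter u j < c - d).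
Hypothesis patT_notL : forall i d, 0 < d < c -> ~ Ldec (pat true i) d.
Hypothesis patF_notR : forall i d, 0 < d < c -> ~ Rdec (pat false i) d.

(** As letters count from 0, [v] is the smallest letter in the window. *)
Definition hit n (w : 'S_n) q i s v :=
  q + c <= n /\ forall j, j < c -> letter w (q + j) = v + letter (pat s i) j.

Definition flip n q i s (w w' : 'S_n) :=
  exists v, [/\ hit w q i s v, hit w' q i (~~ s) v &
    forall x, x < n -> ~~ (q <= x < q + c) -> letter w x = letter w' x].

(** A hit uses up an interval of [c] values, so every position outside the window has its letter
    outside that interval. *)
Lemma hit_window n (w : 'S_n) q i s v x :
  hit w q i s v -> x < n -> (q <= x < q + c) = (v <= letter w x < v + c).
Proof.
move=> [leqn hw] ltx; apply/idP/idP.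
  move=> qx; have -> : x = q + (x - q) by lia.
  rewrite hw; last lia.
  by have := @letter_lt _ (pat s i) (x - q); lia.
move=> vx; have [|j ltj ej] := @letter_surj _ (pat s i) (letter w x - v); first lia.
have : letter w (q + j) = letter w x by rewrite hw //; lia.
by move/letter_inj => /(_ ltac:(lia) ltx); lia.
Qed.

Lemma hit_bound n (w : 'S_n) q i s v : hit w q i s v -> v + c <= n.
Proof.
move=> [leqn hw]; have [|j ltj ej] := @letter_surj _ (pat s i) c.-1; first lia.
by have := hw j ltj; have := @letter_lt _ w (q + j); lia.
Qed.

Lemma hit_letter n (w : 'S_n) q i s v x :
  hit w q i s v -> q <= x < q + c -> letter w x = v + letter (pat s i) (x - q).
Proof. by move=> [_ hw] qx; rewrite -hw; [congr letter|]; lia. Qed.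

Lemma hit_inj n (w : 'S_n) q i s v i' s' v' :
  hit w q i s v -> hit w q i' s' v' -> [/\ i = i', s = s' & v = v'].
Proof.
have le_v i1 s1 v1 i2 s2 v2 : hit w q i1 s1 v1 -> hit w q i2 s2 v2 -> v2 <= v1.
  move=> h1 h2; have [j ltj ej] := @letter_surj _ (pat s1 i1) 0 c_gt0.
  have [leqn hw] := h1; have := hw j ltj; rewrite ej.
  by have := @hit_window _ _ _ _ _ _ (q + j) h2 ltac:(lia); lia.
move=> h h'.
have ev : v = v'.
  by apply/eqP; rewrite eqn_leq (le_v _ _ _ _ _ _ h' h) (le_v _ _ _ _ _ _ h h').
have [//|-> ->] := @pat_inj s i s' i'; last by [].
apply: letter_ext => j ltj; have [[_ hw] [_ hw']] := (h, h').
by have := hw j ltj; rewrite hw' // ev; lia.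
Qed.

(* Both overlapping words have their first letters on the same side of the
   shared ones, so the direction of the shift tells R from L. *)
Lemma hit_overlap n (w : 'S_n) q i s v q' i' s' v' :
    hit w q i s v -> hit w q' i' s' v' -> q < q' < q + c ->
  s = s' /\ (if s then v' + q = v + q' else v + q = v' + q').
Proof.
move=> h h' qq'; set d := q' - q.
have [[leqn _] [leqn' _]] := (h, h').
have [len len'] := (hit_bound h, hit_bound h').
(* The shared positions are those whose letters lie in both value intervals, so these intervals are
   offset by exactly [d], up or down. *)
have ecard : q + c - q' = minn v v' + c - maxn v v'.
  rewrite -(@card_ord_interval n q' (q + c)) //.
  rewrite -(@card_ord_interval n (maxn v v')); last lia.
  rewrite -(card_letter w (fun y => maxn v v' <= y < minn v v' + c)).
  apply: eq_card => x; rewrite !inE.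
  by have := hit_window h (ltn_ord x); have := hit_window h' (ltn_ord x); lia.
have pos j : j < c -> [/\ (d <= j) = (v' <= letter w (q + j) < v' + c),
    (j + d < c) = (v <= letter w (q' + j) < v + c),
    letter w (q + j) = v + letter (pat s i) j /\ letter (pat s i) j < c,
    letter w (q' + j) = v' + letter (pat s' i') j &
    letter (pat s' i') j < c].
  move=> ltj; rewrite !letter_lt // -(hit_window h) -?(hit_window h'); try lia.
  by case: h h' => _ -> // [_ ->] //; split => //; rewrite /d; lia.
(* An upward offset gives R decompositions of the first word at [d] and of the second at [c - d],
   impossible for [a]-patterns; a downward one gives L decompositions at the same cuts, impossible
   for [b]-patterns. *)
have [ev|ev] : v' = v + d \/ v = v' + d by rewrite /d; lia.
  case: s => [|] in h pos *; last first.
    by case: (@patF_notR i d); [rewrite /d; lia|move=> j /pos[]; lia].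
  case: s' => [|] in h' pos *; last first.
    by case: (@patF_notR i' (c - d)); [rewrite /d; lia|move=> j /pos[]; lia].
  by split => //; rewrite ev /d; lia.
case: s => [|] in h pos *.
  by case: (@patT_notL i d); [rewrite /d; lia|move=> j /pos[]; lia].
case: s' => [|] in h' pos *.
  by case: (@patT_notL i' (c - d)); [rewrite /d; lia|move=> j /pos[]; lia].
by split => //; rewrite ev /d; lia.
Qed.

Lemma flip_sym n q i s (w w' : 'S_n) : flip q i s w w' -> flip q i (~~ s) w' w.
Proof.
move=> [v [h h' eqw]]; exists v; rewrite negbK; split=> // x ltx nqx.
by rewrite eqw.
Qed.

Lemma flip_exists n (w : 'S_n) q i s v :
  hit w q i s v -> exists w', flip q i s w w'.
Proof.
move=> h; have [leqn hw] := h; have len := hit_bound h.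
pose f x := if q <= x < q + c then v + letter (pat (~~ s) i) (x - q) else letter w x.
have u_lt x : q <= x < q + c -> letter (pat (~~ s) i) (x - q) < c.
  by move=> qx; apply: letter_lt; lia.
have [x ltx||w' ew'] := @perm_of_letters n f.
- rewrite /f; case: ifP => qx; last by rewrite letter_lt.
  by have := u_lt _ qx; lia.
- move=> x y ltx lty; rewrite /f.
  have := hit_window h ltx; have := hit_window h lty.
  case: ifP => qx; case: ifP => qy; rewrite ?qx ?qy => hx hy.
  + by move=> /addnI/letter_inj; lia.
  + by have := u_lt _ qx; lia.
  + by have := u_lt _ qy; lia.
  + exact: letter_inj.
exists w', v; split=> //.
  split=> // j ltj; rewrite ew' /f; last lia.
  rewrite ifT; last lia.
  by congr (_ + letter _ _); lia.
by move=> x ltx nqx; rewrite ew' /f ?(negbTE nqx).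
Qed.

Lemma flip_inj n q i s i' s' (w w1 w2 : 'S_n) :
  flip q i s w w1 -> flip q i' s' w w2 -> w1 = w2.
Proof.
move=> [v [h h1 e1]] [v' [h' h2 e2]].
have [ei es ev] := hit_inj h h'; rewrite -ei -es -ev in h2.
apply: letter_ext => x ltx; case: (boolP (q <= x < q + c)) => qx.
  by rewrite (hit_letter h1) ?(hit_letter h2).
by rewrite -e1 ?e2.
Qed.

(** * Commutation of disjoint flips *)

Definition apart p q := (p + c <= q) || (q + c <= p).

Lemma flip_hit n p q i s j t v (w w' : 'S_n) :
  apart p q -> flip p i s w w' -> hit w q j t v -> hit w' q j t v.
Proof.
move=> ap [v0 [h h' e]] [leqn hq]; split=> // x ltx.
rewrite -e ?hq //; [lia|]; move: ap; rewrite /apart; lia.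
Qed.

Lemma flip_diamond n p q i s j t (w w1 w2 : 'S_n) :
    apart p q -> flip p i s w w1 -> flip q j t w w2 ->
  exists2 w', flip q j t w1 w' & flip p i s w2 w'.
Proof.
move=> ap f1 f2; have ap' : apart q p by move: ap; rewrite /apart; lia.
have [v1 [h1 h1' e1]] := f1; have [v2 [h2 h2' e2]] := f2.
have [w' f1'] := flip_exists (flip_hit ap f1 h2).
have [w'' f2'] := flip_exists (flip_hit ap' f2 h1).
exists w' => //; suff -> : w' = w'' by [].
have [[u1 [g1 g1' d1]] [u2 [g2 g2' d2]]] := (f1', f2').
have [_ _ eu1] := hit_inj g1 (flip_hit ap f1 h2).
have [_ _ eu2] := hit_inj g2 (flip_hit ap' f2 h1); subst u1 u2.
apply: letter_ext => x ltx.
case: (boolP (p <= x < p + c)) => px.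
  rewrite (hit_letter g2') // -d1 //; last by move: ap; rewrite /apart; lia.
  exact: hit_letter h1' _.
case: (boolP (q <= x < q + c)) => qx.
  by rewrite (hit_letter g1') // -d2 // (hit_letter h2').
by rewrite -d1 // -e1 // -d2 // -e2.
Qed.

(** * Equivalence under flips starting before a bound *)

Definition step n p : rel 'S_n :=
  fun w w' => `[< exists q i s, q < p /\ flip q i s w w' >].

(** The bound [p.+1 - c], frequent below, admits exactly the flips whose windows end at or before
    [p]: [q < p.+1 - c] means [q + c <= p]. *)
Definition eqv n p : rel 'S_n := connect (step p).

Lemma stepP n p (w w' : 'S_n) :
  reflect (exists q i s, q < p /\ flip q i s w w') (step p w w').
Proof. exact: asboolP. Qed.

Lemma step_sym n p : symmetric (@step n p).
Proof.
by move=> w w'; apply/stepP/stepP=> -[q [i [s [ltq /flip_sym f]]]];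
  exists q, i, (~~ s).
Qed.

Lemma eqv_refl n p (w : 'S_n) : eqv p w w.
Proof. exact: connect0. Qed.

Lemma eqv_sym n p : symmetric (@eqv n p).
Proof. exact: (sym_connect_sym (@step_sym n p)). Qed.

Lemma eqv_trans n p : transitive (@eqv n p).
Proof. exact: connect_trans. Qed.

Lemma flip_eqv n p q i s (w w' : 'S_n) : q < p -> flip q i s w w' -> eqv p w w'.
Proof. by move=> ltq f; apply/connect1/stepP; exists q, i, s. Qed.

Lemma eqv_ind n p (w : 'S_n) (Q : 'S_n -> Prop) :
    Q w ->
    (forall q i s y z, q < p -> flip q i s y z -> Q y -> Q z) ->
  forall w', eqv p w w' -> Q w'.
Proof.
move=> Qw QS w' /connectP[t]; elim: t w Qw => [|y t IHt] w Qw /= => [_ -> //|].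
case/andP=> /stepP[q [i [s [ltq f]]]] pt ew'.
exact: IHt (QS q i s w y ltq f Qw) pt ew'.
Qed.

Lemma eqv_mono n p p' (w w' : 'S_n) : p <= p' -> eqv p w w' -> eqv p' w w'.
Proof.
move=> lepp'; move: w'; apply: eqv_ind => [|q i s y z ltq f]; first exact: eqv_refl.
by move/eqv_trans; apply; apply: flip_eqv f; lia.
Qed.

(** All flips of the path have windows left of [q], so the flip at [q] is carried along it by
    [flip_diamond]. *)
Lemma eqv_flip n q i s (w w' w1 : 'S_n) :
    eqv (q.+1 - c) w w1 -> flip q i s w w' ->
  exists2 w1', flip q i s w1 w1' & eqv (q.+1 - c) w' w1'.
Proof.
move=> ww1 f; move: w1 ww1; apply: eqv_ind => [|q' i' s' y z ltq' f' [y' fy ey]].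
  by exists w' => //; apply: eqv_refl.
have [|z' f1 f2] := flip_diamond _ fy f'; first by rewrite /apart; lia.
by exists z' => //; apply: eqv_trans ey (flip_eqv ltq' f1).
Qed.

(* Flipping [q] destroys an overlapping hit at [p], and the letters of that
   hit outside the window of [q] forbid any other hit meeting this window. *)
Lemma flip_isolates n p q i j s v (w w' : 'S_n) q' i' s' v' :
    hit w p i s v -> p < q + c -> q < p -> flip q j s w w' ->
    hit w' q' i' s' v' -> q' <= p ->
  apart q q' \/ q = q'.
Proof.
move=> hp ltpq ltqp [vq [hq hq' e]] h' leq'p.
have [->|neq] := eqVneq q q'; first by right.
have [?|nap] := boolP (apart q q'); [by left|exfalso].
have [_ shift] := hit_overlap hq hp ltac:(lia).
have [leqn _] := hp; have [leqn' _] := h'; have lenp := hit_bound hp.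
have lenq := hit_bound hq.
have [ltqq'|leq'q] := ltnP q q'.
  have [_ shift'] := hit_overlap hq' h' ltac:(lia).
  (* Position [q + c] is in the windows of [p] and [q'] but not of [q]. After the flip the shifts
     reverse, so one hit puts its letter above the values of the window of [q] and the other
     below. *)
  have wp := hit_window (x := q + c) hp ltac:(lia).
  have wq := hit_window (x := q + c) hq ltac:(lia).
  have wq' := hit_window (x := q + c) h' ltac:(lia).
  have := e (q + c) ltac:(lia) ltac:(lia).
  by case: s hp hq hq' shift shift' {e} => /=; lia.
have [es' shift'] := hit_overlap h' hq' ltac:(move: nap; rewrite /apart; lia).
(* The value [y], next to those of the window of [q], belongs to the hits at [p] and at [q']. Its
   position would be right of the window of [q] by the first and left of it by the second. *)
pose y := if s then vq + c else vq.-1.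
have [|x ltx ex] := @letter_surj _ w y.
  by rewrite /y; case: s hp hq hq' shift {e es' y} => /=; lia.
have wp := hit_window hp ltx; have wq := hit_window hq ltx.
have wq' := hit_window h' ltx; have := e x ltx.
rewrite ex in wp wq *.
rewrite es' in shift'; rewrite /apart in nap.
move: shift shift' wp wq wq' neq leq'q {hp hq hq' h' es' e ex}.
by rewrite /y; case: s {y} => /=; lia.
Qed.

(** A flip that destroys the hit must be undone before any other flip meets its window, and the
    flips made meanwhile commute with it; only flips disjoint from the window of [p] remain. *)
Lemma eqv_hit_uniq n p (w w' : 'S_n) i s v i' s' v' :
    hit w p i s v -> eqv p w w' -> hit w' p i' s' v' ->
  [/\ i = i', s = s' & eqv (p.+1 - c) w w'].
Proof.
move=> hw ww' hw'.
(* Invariant along the path: the hit at [p] is intact, or exactly one flip, overlapping it,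
   separates [z] from such a word [z0]. *)
pose Q z := (hit z p i s v /\ eqv (p.+1 - c) w z) \/
  exists q j z0, [/\ q < p, p < q + c, hit z0 p i s v, eqv (p.+1 - c) w z0 &
                   flip q j s z0 z].
suff [[h ez]|[q [j [z0 [ltqp ltpq hp ez f]]]]] : Q w'.
- by have [-> -> _] := hit_inj h hw'.
- by have [] := flip_isolates hp ltpq ltqp f hw' (leqnn p); rewrite ?/apart; lia.
move: w' ww' {hw'}; apply: eqv_ind => [|q i1 s1 y z ltqp f].
  by left; split=> //; apply: eqv_refl.
case=> [[h ey]|[q0 [j [z0 [ltq0 ltpq0 hp ez f0]]]]].
  have [leqcp|ltpqc] := leqP (q + c) p.
    left; split; first by apply: flip_hit f h; rewrite /apart; lia.
    by apply: eqv_trans ey (flip_eqv _ f); lia.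
  have [v1 [h1 _ _]] := f.
  have [es _] := hit_overlap h1 h ltac:(lia).
  by rewrite es in f; right; exists q, i1, y; split.
have [v1 [h1 _ _]] := f.
(* With a flip at [q0] pending, the next flip either undoes it or is disjoint from it; in the latter
   case [q < p] puts it to the left of [q0]. *)
have [ap|eq] := flip_isolates hp ltpq0 ltq0 f0 h1 (ltnW ltqp); last first.
  left; rewrite -eq in f; suff -> : z = z0 by split.
  exact: flip_inj f (flip_sym f0).
right; have f1 := flip_sym f0.
have ap' : q + c <= q0 by move: ap; rewrite /apart; lia.
have [|z1 g1 g2] := flip_diamond _ f f1; first by rewrite /apart; lia.
exists q0, j, z1; split=> //.
- by apply: flip_hit g2 hp; rewrite /apart; lia.
- by apply: eqv_trans ez (flip_eqv _ g2); lia.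
by rewrite -[s]negbK; apply: flip_sym.
Qed.

(** * Contracting a [b_i] at position [p] to one letter *)

Definition skip v t := if t <= v then t else t + c.-1.

(* [w] arises from [y] by substituting the word [pat true i] for the letter at
   position [p]. *)
Definition inflation m n p i (y : 'S_m) (w : 'S_n) :=
  exists v, [/\ hit w p i true v, letter y p = v &
    forall x, x < m -> x != p ->
      letter w (if x < p then x else x + c.-1) = skip v (letter y x)].

Section Inflation.
Variables (m n p : nat).
(** The equation says [m = n - c + 1] without truncated subtraction; [p < m] then means that the
    window at [p] fits into [n] positions. *)
Hypotheses (en : n.+1 = m + c) (ltpm : p < m).

Lemma inflation_exists i (y : 'S_m) : exists w : 'S_n, inflation p i y w.
Proof.
set v := letter y p; have ltv : v < m by apply: letter_lt.
pose f x := if x < p then skip v (letter y x) else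
  if x < p + c then v + letter (pat true i) (x - p)
  else skip v (letter y (x - c.-1)).
have ltu x : p <= x < p + c -> letter (pat true i) (x - p) < c.
  by move=> px; apply: letter_lt; lia_ifs.
have lty x : x < m -> x != p -> letter y x < m /\ letter y x != v.
  move=> ltx neq; split; first exact: letter_lt.
  by apply: contra_neq neq; apply: letter_inj.
have [x ltx||w ew] := @perm_of_letters n f.
- rewrite /f /skip; case: ifP => [ltxp|lepx].
    by have := lty x ltac:(lia) ltac:(lia); lia_ifs.
  case: ifP => [ltxpc|lepcx]; first by have := ltu x; lia_ifs.
  by have := lty (x - c.-1) ltac:(lia) ltac:(lia); lia_ifs.
(* The window fills the values from [v] to [v + c - 1]; away from [v], [skip v] is injective and
   avoids these values. *)
- have key x x' : x < n -> x' < n -> x <= x' -> f x = f x' -> x = x'.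
    move=> ltx ltx' lexx'; rewrite /f /skip.
    have [ltxp|lepx] := ltnP x p.
      have [yx nyx] := lty x ltac:(lia) ltac:(lia).
      have [ltxp'|lepx'] := ltnP x' p.
        have [yx' nyx'] := lty x' ltac:(lia) ltac:(lia).
        move=> eyy; apply: (@letter_inj _ y); try lia.
        by move: eyy; lia_ifs.
      have [ltxpc|lepcx] := ltnP x' (p + c); first by have := ltu x'; lia_ifs.
      have [yx' nyx'] := lty (x' - c.-1) ltac:(lia) ltac:(lia).
      move=> eyy; suff : x = x' - c.-1 by lia.
      by apply: (@letter_inj _ y); try lia; move: eyy; lia_ifs.
    have [ltxpc|lepcx] := ltnP x (p + c).
      have := ltu x ltac:(lia); have [ltxpc' u|lepcx'] := ltnP x' (p + c).
        by rewrite ltnNge (leq_trans lepx) //= => /addnI/letter_inj; lia.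
      have [yx' nyx'] := lty (x' - c.-1) ltac:(lia) ltac:(lia).
      by lia_ifs.
    have [yx nyx] := lty (x - c.-1) ltac:(lia) ltac:(lia).
    have [yx' nyx'] := lty (x' - c.-1) ltac:(lia) ltac:(lia).
    move=> eyy; suff : x - c.-1 = x' - c.-1 by lia.
    by apply: (@letter_inj _ y); try lia; move: eyy; lia_ifs.
  move=> x x' ltx ltx' eff; have [le|/ltnW le] := leqP x x'; first exact: key.
  by apply/esym/key.
exists w, v; split=> //.
  split=> [|j ltj]; first lia.
  by rewrite ew /f; [rewrite ifF ?ifT; try lia; congr (_ + letter _ _)|]; lia_ifs.
move=> x ltx neq; case: ifP => ltxp; rewrite ew /f; try lia.
  by rewrite ltxp.
by rewrite !ifF; try lia; congr (skip _ (letter _ _)); lia_ifs.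
Qed.

Lemma deflation_exists i v (w : 'S_n) :
  hit w p i true v -> exists y : 'S_m, inflation p i y w.
Proof.
move=> h; have [leqn hw] := h; have len := hit_bound h.
pose pos x := if x < p then x else x + c.-1.
pose down t := if t < v then t else t - c.-1.
pose f x := if x == p then v else down (letter w (pos x)).
(* Positions outside the window have letters outside its value interval, where [down] is inverse to
   [skip v]. *)
have ltpos x : x < m -> x != p -> [/\ pos x < n, letter w (pos x) < n &
    (letter w (pos x) < v) || (v + c <= letter w (pos x))].
  move=> ltx neq; have lt : pos x < n by rewrite /pos; lia_ifs.
  have : (p <= pos x < p + c) = false by rewrite /pos; lia_ifs.
  by rewrite (hit_window h lt); have := letter_lt w lt; split=> //; lia.
have [x ltx||y ey] := @perm_of_letters m f.
- rewrite /f /down; case: eqP => [|/eqP neq]; first lia.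
  by have [] := ltpos x ltx neq; lia_ifs.
- move=> x x' ltx ltx'; rewrite /f /down.
  case: eqP => [->|/eqP neq]; case: eqP => [->|/eqP neq'] //.
  + by have [] := ltpos x' ltx' neq'; lia_ifs.
  + by have [] := ltpos x ltx neq; lia_ifs.
  have [lt1 lt2 o] := ltpos x ltx neq.
  have [lt1' lt2' o'] := ltpos x' ltx' neq'.
  move=> ee; suff : pos x = pos x' by rewrite /pos; lia_ifs.
  by apply: (@letter_inj _ w) => //; move: ee; lia_ifs.
exists y, v; split=> //; first by rewrite ey // /f eqxx.
move=> x ltx neq; rewrite ey // /f (negbTE neq) /skip /down -/(pos x).
have [_ _ o] := ltpos x ltx neq.
by have [ltv|lev] := ltnP (letter w (pos x)) v; lia_ifs.
Qed.

Lemma inflation_inj i (y : 'S_m) (w w' : 'S_n) :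
  inflation p i y w -> inflation p i y w' -> w = w'.
Proof.
move=> [v [h ev e]] [v' [h' ev' e']].
rewrite -ev' ev in e' h'; have [leqn _] := h.
apply: letter_ext => x ltx.
have [ltxp|lepx] := ltnP x p.
  have := e x ltac:(lia) ltac:(lia); have := e' x ltac:(lia) ltac:(lia).
  by rewrite ltxp => -> ->.
have [ltxpc|lepcx] := ltnP x (p + c).
  by rewrite (hit_letter h) 1?(hit_letter h') //; lia_ifs.
have := e (x - c.-1) ltac:(lia) ltac:(lia).
have := e' (x - c.-1) ltac:(lia) ltac:(lia).
by rewrite ifF ?subnK; [move=> -> ->|lia..].
Qed.

Lemma deflation_inj i i' (y y' : 'S_m) (w : 'S_n) :
  inflation p i y w -> inflation p i' y' w -> y = y'.
Proof.
move=> [v [h ev e]] [v' [h' ev' e']].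
have [ei _ evv'] := hit_inj h h'; rewrite -evv' in e'.
apply: letter_ext => x ltx; have [->|neq] := eqVneq x p; first by rewrite ev ev'.
have := e x ltx neq; rewrite e' // /skip; lia_ifs.
Qed.

(** The window avoids [p], so the values of the hit all lie on one side of [v] and [skip v]
    translates them together. *)
Lemma skip_hit (y : 'S_m) q j s v t :
    q + c <= p -> letter y p = v -> hit y q j s t ->
  forall d, d < c -> skip v (t + d) = skip v t + d.
Proof.
move=> leqp ev h d ltd; have := hit_window h ltpm.
by rewrite /skip ev; lia_ifs.
Qed.

Lemma hit_inflation i (y : 'S_m) (w : 'S_n) q j s t :
    q + c <= p -> inflation p i y w -> hit y q j s t ->
  hit w q j s (skip (letter y p) t).
Proof.
move=> leqp [v [h ev e]] hq; split; first by have [] := h; lia_ifs.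
move=> d ltd; have := e (q + d) ltac:(lia) ltac:(lia).
rewrite ifT; last lia.
move=> ->; have [_ hy] := hq; rewrite hy // ev.
by rewrite (skip_hit leqp ev hq) //; apply: letter_lt.
Qed.

Lemma hit_deflation i (y : 'S_m) (w : 'S_n) q j s t :
    q + c <= p -> inflation p i y w -> hit w q j s t ->
  exists t', hit y q j s t'.
Proof.
move=> leqp [v [h ev e]] hq.
(* If the two value intervals met, both would contain [maxn v t], and its position would lie in two
   disjoint windows. *)
have dis : (t + c <= v) || (v + c <= t).
  have lent := hit_bound hq; have lenv := hit_bound h.
  have [x ltx ex] := @letter_surj _ w (maxn v t) ltac:(lia).
  by have := hit_window h ltx; have := hit_window hq ltx; rewrite ex; lia_ifs.
exists (if t < v then t else t - c.-1); split; first lia.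
move=> d ltd; have := e (q + d) ltac:(lia) ltac:(lia).
have [_ hw] := hq; rewrite ifT; last lia.
by rewrite hw // /skip; have := letter_lt (pat s j) ltd; lia_ifs.
Qed.

Lemma inflation_flip i (y y' : 'S_m) (w w' : 'S_n) q j s :
    q + c <= p -> inflation p i y w -> flip q j s y y' -> flip q j s w w' ->
  inflation p i y' w'.
Proof.
move=> leqp inf [t [hy hy' ey]] fw; have [t' [hw hw' ew]] := fw.
have [_ _ et] := hit_inj (hit_inflation leqp inf hy) hw.
have [v [h ev e]] := inf; rewrite ev in et.
have [lepcn _] := h.
exists v; split.
- by apply: flip_hit fw h; rewrite /apart; lia_ifs.
- by rewrite -ey //; lia_ifs.
move=> x ltx neq.
have [qx|nqx] := boolP (q <= x < q + c).
  rewrite ifT; last lia.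
  rewrite (hit_letter hw') // (hit_letter hy') // -et.
  by rewrite (skip_hit leqp ev hy) //; apply: letter_lt; lia_ifs.
rewrite -ey // -e // -ew //; first by lia_ifs.
by move: nqx leqp lepcn ltx neq en; clear; lia_ifs.
Qed.

(** Contraction moves no position left of [p], so paths of flips ending at or before [p] lift and
    descend one flip at a time. *)
Lemma inflation_eqv i (y y' : 'S_m) (w w' : 'S_n) :
    inflation p i y w -> inflation p i y' w' ->
  eqv (p.+1 - c) w w' = eqv (p.+1 - c) y y'.
Proof.
move=> inf inf'; apply/idP/idP => [ww'|yy'].
  pose Q (z : 'S_n) := exists2 yz : 'S_m, inflation p i yz z & eqv (p.+1 - c) y yz.
  suff [yz infz] : Q w' by rewrite (deflation_inj infz inf').
  move: w' ww' {inf'}; apply: eqv_ind => [|q j s z z' ltq f [yz infz eyz]].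
    by exists y => //; apply: eqv_refl.
  have leqp : q + c <= p by lia.
  have [t [hz _ _]] := f; have [t' hy] := hit_deflation leqp infz hz.
  have [yz' fy] := flip_exists hy; exists yz'.
    exact: inflation_flip infz fy f.
  exact: eqv_trans eyz (flip_eqv ltq fy).
pose Q (yz : 'S_m) := exists2 z : 'S_n, inflation p i yz z & eqv (p.+1 - c) w z.
suff [z infz] : Q y' by rewrite (inflation_inj infz inf').
move: y' yy' {inf'}; apply: eqv_ind => [|q j s yz yz' ltq f [z infz ez]].
  by exists w => //; apply: eqv_refl.
have leqp : q + c <= p by lia.
have [t [hy _ _]] := f; have [z' fz] := flip_exists (hit_inflation leqp infz hy).
exists z'; first exact: inflation_flip infz f fz.
exact: eqv_trans ez (flip_eqv ltq fz).
Qed.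

End Inflation.

(** * Counting classes *)

Definition cls n p (w : 'S_n) : {set 'S_n} := [set w' | eqv p w w'].
Definition nclasses n p := #|cls p @: [set: 'S_n]|.

Lemma eqv_congl n p (w w' z : 'S_n) : eqv p w w' -> eqv p w z = eqv p w' z.
Proof. by move=> ww'; apply: (same_connect (@eqv_sym n p) ww' z). Qed.

Lemma eqv_congr n p (w w' z : 'S_n) : eqv p w w' -> eqv p z w = eqv p z w'.
Proof. by rewrite ![eqv p z _]eqv_sym; apply: eqv_congl. Qed.

Lemma cls_eq n p (w w' : 'S_n) : (cls p w == cls p w') = eqv p w w'.
Proof.
apply/eqP/idP => [/setP/(_ w')|ww']; first by rewrite !inE eqv_refl.
by apply/setP => z; rewrite !inE (eqv_congl _ ww').
Qed.

Lemma eqv0 n (w w' : 'S_n) : eqv 0 w w' = (w == w').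
Proof.
apply/idP/eqP => [|->]; last exact: eqv_refl.
by move: w'; apply: eqv_ind.
Qed.

Lemma nclasses0 n : nclasses n 0 = n`!.
Proof.
rewrite /nclasses card_imset ?cardsT ?card_Sn //.
by move=> w w' /eqP; rewrite cls_eq eqv0 => /eqP.
Qed.

(** One flip at [p] suffices: of two successive ones, the second undoes the first up to flips
    disjoint from the window of [p]. *)
Lemma eqvS n p (w w' : 'S_n) : eqv p.+1 w w' ->
  eqv p w w' \/ exists i s z z', [/\ eqv p w z, flip p i s z z' & eqv p z' w'].
Proof.
move: w'; apply: eqv_ind => [|q i s y z ltq f]; first by left; apply: eqv_refl.
have [ltqp|leqp] := ltnP q p.
  have eyz := flip_eqv ltqp f.
  case=> [wy|[j [t [u [u' [wu fu uy]]]]]]; first by left; apply: eqv_trans wy eyz.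
  by right; exists j, t, u, u'; split=> //; apply: eqv_trans uy eyz.
have eqp : q = p by lia.
rewrite {}eqp {ltq leqp} in f.
case=> [wy|[j [t [u [u' [wu fu uy]]]]]].
  by right; exists i, s, y, z; split=> //; apply: eqv_refl.
have [[v [hy _ _]] [v' [_ hu' _]]] := (f, fu).
have [_ _ eu'y] := eqv_hit_uniq hu' uy hy.
left; have [z2 fz2 ez2] := eqv_flip eu'y (flip_sym fu).
rewrite (flip_inj f fz2).
apply: eqv_trans wu (eqv_mono _ ez2); lia.
Qed.

Section Recursion.
Variables (m n p : nat).
Hypotheses (en : n.+1 = m + c) (ltpm : p < m).

Let B := [set w : 'S_n | `[< exists w' i v, eqv p w w' /\ hit w' p i true v >]].

Lemma BP (w : 'S_n) :
  reflect (exists w' i v, eqv p w w' /\ hit w' p i true v) (w \in B).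
Proof. by rewrite inE; apply: asboolP. Qed.

(* A class for flips starting before [p] meets at most one class of words with a
   hit at [p], so allowing flips at [p] merges the former in disjoint pairs. *)
Lemma nclassesS_complement : nclasses n p.+1 = #|cls p @: ~: B|.
Proof.
apply: (card_imset_rel (r := fun x y => eqv p.+1 x y /\ y \in ~: B)) => [x _|y yB|].
- have [/BP[w [i [v [xw h]]]]|xB] := boolP (x \in B); last first.
    by rewrite -in_setC in xB; exists x => //; split=> //; apply: eqv_refl.
  have [w' f] := flip_exists h; have [v' [_ h' _]] := f.
  suff w'B : w' \in ~: B.
    exists w' => //; split=> //; apply: eqv_trans (eqv_mono (leqnSn p) xw) _.
    exact: flip_eqv (ltnSn p) f.
  (* The [a]-hit of [w'] at [p] excludes a [b]-hit at [p] in its class. *)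
  rewrite in_setC; apply/BP => -[z [i' [u [w'z hz]]]].
  by have [_] := eqv_hit_uniq h' w'z hz.
- by exists y => //; split=> //; apply: eqv_refl.
move=> x y x' y' _ _ [xy yB] [xy' yB'].
rewrite !cls_eq (eqv_congl _ xy).
rewrite (eqv_congr _ xy').
(* A flip at [p] has a [b]-hit on one of its sides, which would put [y] or [y'] in [B]. *)
apply/idP/idP => [/eqvS[//|[i [s [z [z' [yz f zy]]]]]]|]; last exact: eqv_mono.
have [v [h h' _]] := f; case: s h h' {f} => h h'.
  by move: yB; rewrite in_setC => /BP[]; exists z, i, v.
by move: yB'; rewrite in_setC => /BP[]; exists z', i, v; rewrite eqv_sym.
Qed.

(** By [eqv_hit_uniq], the words with a hit at [p] in one such class share their index [i] and form
    one class for the flips left of [p]; contraction turns it into a class of ['S_m]. *)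
Lemma nclasses_hit : #|cls p @: B| = k * nclasses m (p.+1 - c).
Proof.
pose g (iy : 'I_k * 'S_m) := (iy.1, cls (p.+1 - c) iy.2).
have -> : k * nclasses m (p.+1 - c) = #|g @: [set: 'I_k * 'S_m]|.
  rewrite (_ : _ * _ = #|[set: 'I_k]| * nclasses m (p.+1 - c)); last first.
    by rewrite cardsT card_ord.
  rewrite -cardsX; apply: eq_card => -[i K].
  rewrite !inE /=; apply/imsetP/imsetP => [[y _ ->]|[[j y] _ [_ ->]]].
    by exists (i, y); rewrite ?inE.
  by exists y; rewrite ?inE.
pose r (x : 'S_n) (iy : 'I_k * 'S_m) := exists2 w, eqv p x w & inflation p iy.1 iy.2 w.
apply: (card_imset_rel (r := r)) => [x /BP[w [i [v [xw h]]]]|[i y] _|].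
- have [y inf] := deflation_exists en ltpm h.
  by exists (i, y); [rewrite inE|exists w].
- have [w inf] := inflation_exists en ltpm i y.
  exists w; last by exists w => //; apply: eqv_refl.
  by have [v [h _ _]] := inf; apply/BP; exists w, i, v; split=> //; apply: eqv_refl.
move=> x [i y] x' [i' y'] _ _ [w xw inf] [w' xw' inf'] /=.
rewrite cls_eq (eqv_congl _ xw).
rewrite (eqv_congr _ xw') xpair_eqE cls_eq /=.
rewrite /= in inf inf'; apply/idP/andP => [ww'|[/eqP ei yy']].
  have [[v [h _ _]] [v' [h' _ _]]] := (inf, inf').
  have [ei _ eww'] := eqv_hit_uniq h ww' h'.
  by rewrite -ei in inf' *; rewrite -(inflation_eqv en ltpm inf inf').
rewrite -ei in inf'; apply: (@eqv_mono _ (p.+1 - c)); first lia.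
by rewrite (inflation_eqv en ltpm inf inf').
Qed.

Lemma nclasses_rec : nclasses n p = nclasses n p.+1 + k * nclasses m (p.+1 - c).
Proof.
rewrite nclassesS_complement -nclasses_hit /nclasses addnC -(setUCr B) imsetU.
rewrite cardsU (_ : _ :&: _ = set0) ?cards0 ?subn0 //.
apply/setP=> K; rewrite !inE; apply/negP => /andP[/imsetP[x xB ->] /imsetP[y yB]].
move/eqP; rewrite cls_eq => xy; move: yB; rewrite in_setC => /BP[].
have /BP[w [i [v [xw h]]]] := xB; exists w, i, v; split=> //.
by apply: eqv_trans xw; rewrite eqv_sym.
Qed.

End Recursion.
End Hits.

(** * Solving the recursion *)

Section ClosedForm.
Variables (c k : nat) (f : nat -> nat -> nat).
Hypothesis c_gt0 : 0 < c.
Hypothesis f0 : forall n, f n 0 = n`!.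
Hypothesis f_rec : forall m n p, n.+1 = m + c -> p < m ->
  f n p = f n p.+1 + k * f m (p.+1 - c).

(* The number of [j]-subsets of [{0, ..., p - 1}] with pairwise distances at
   least [c]. *)
Definition spread p j := 'C(p - c.-1 * j.-1, j).

(** Either [p] is not chosen, or the other elements are at most [p - c]. In binomials this is
    Pascal's rule. *)
Lemma spread_rec p j : spread p.+1 j.+1 = spread p j.+1 + spread (p.+1 - c) j.
Proof.
rewrite /spread /=; case: j => [|j] /=.
  by rewrite !muln0 !subn0 !bin1 bin0 addn1.
rewrite mulnS (_ : p.+1 - c = p - c.-1); last lia.
rewrite -subnDA; have [le|lt] := leqP (c.-1 + c.-1 * j) p.
  by rewrite subSn // binS.
by rewrite !bin_small //; lia.
Qed.

Local Open Scope ring_scope.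

(** Each chosen position contributes a factor [-k] and shortens the word by [c - 1]. Terms with
    [j > p] vanish, so [N] may be any bound on [p], which leaves it free in the induction. *)
Lemma closed_form p n N : (p <= N)%N -> p = 0%N \/ (p + c <= n.+1)%N ->
  ((f n p)%:R : rat) = \sum_(j < N.+1)
    (-1) ^+ j * k%:R ^+ j * (spread p j)%:R * ((n - c.-1 * j)`!)%:R.
Proof.
elim/ltn_ind: p n N => -[|p] IHp n N leN.
  move=> _; rewrite big_ord_recl /= big1 => [|j _].
    by rewrite f0 muln0 subn0 /spread bin0 !expr0 !mul1r addr0.
  by rewrite /spread /bump /= bin_small ?mulr0 ?mul0r //.
case=> // lepn; case: N leN => // N leN.
set m := (n.+1 - c)%N.
have /(congr1 (fun t => t%:R : rat)) := @f_rec m n p ltac:(lia) ltac:(lia).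
rewrite natrD natrM => /(canLR (addrK _)) <-.
rewrite (IHp p _ n N.+1) //; [|lia|by right; lia].
rewrite (IHp (p.+1 - c)%N _ m N); [|lia|lia|lia].
(* Term [j + 1] of the first sum is matched with term [j] of the second. *)
rewrite big_ord_recl [in RHS]big_ord_recl /= /spread !bin0.
rewrite -addrA; congr (_ + _); rewrite mulr_sumr -sumrB.
apply: eq_bigr => j _; rewrite -/(spread _ _) /bump /= add1n.
rewrite -[X in _ = _ * X%:R * _]/(spread p.+1 j.+1) spread_rec /spread /=.
rewrite (_ : (m - c.-1 * j = n - c.-1 * j.+1)%N); last by rewrite /m mulnS; lia.
rewrite !exprS natrD; ring.
Qed.

End ClosedForm.

Local Open Scope ring_scope.

(** For [M = n - (c - 1) j], the second factor [M!] comes from the binomial of [M] over [j], which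
    is 0 when [c j > n]. *)
Lemma spread_factorial c k n j : (0 < c <= n)%N ->
  (-1) ^+ j * k%:R ^+ j * (spread c (n.+1 - c) j)%:R * ((n - c.-1 * j)`!)%:R =
  (if (c * j <= n)%N then ((-1) ^+ j * ((n - c * j + j)`! ^ 2)%N%:R * k%:R ^+ j)
      / ((j`!)%N%:R * ((n - c * j)`!)%N%:R) else 0) :> rat.
Proof.
move=> /andP[c_gt0 le_cn]; rewrite /spread.
(* The tops can differ only at [j = 0], where both binomials are 1. *)
have -> : 'C(n.+1 - c - c.-1 * j.-1, j) = 'C(n - c.-1 * j, j).
  case: j => [|j]; first by rewrite !bin0.
  by congr 'C(_, _); rewrite /= mulnS; lia.
have ecj : (c * j = c.-1 * j + j)%N by rewrite -{1}(prednK c_gt0) mulSn addnC.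
case: leqP => [le|lt]; last by rewrite bin_small ?mulr0 ?mul0r //; lia.
have -> : (n - c * j + j = n - c.-1 * j)%N by lia.
have -> : (n - c * j = n - c.-1 * j - j)%N by lia.
set M := (n - c.-1 * j)%N; have lejM : (j <= M)%N by rewrite /M; lia.
have /(congr1 (fun t => t%:R : rat)) := bin_fact lejM; rewrite !natrM => <-.
have nz i : (i`!)%:R != 0 :> rat by rewrite pnatr_eq0 -lt0n fact_gt0.
by field; rewrite !nz.
Qed.

(** * Leaning read off the letters, which [word] counts from 1 *)

Definition letters (v : seq nat) : seq int := [seq Posz x.+1 | x <- v].

Lemma wordE n (w : 'S_n) : word w = letters [seq letter w x | x <- iota 0 n].
Proof.
rewrite /word /letters -val_enum_ord -!map_comp.
by apply: eq_map => i; rewrite /= letterE.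
Qed.

Lemma size_word n (w : 'S_n) : size (word w) = n.
Proof. by rewrite wordE !size_map size_iota. Qed.

Lemma nth_word n (w : 'S_n) x : (x < n)%N -> nth 0 (word w) x = Posz (letter w x).+1.
Proof.
move=> ltx; rewrite wordE /letters -map_comp (nth_map 0%N) ?size_iota //=.
by rewrite nth_iota.
Qed.

Lemma perm_letters n (w : 'S_n) : perm_eq [seq letter w x | x <- iota 0 n] (iota 0 n).
Proof.
apply: uniq_perm; rewrite ?iota_uniq //.
  rewrite map_inj_in_uniq ?iota_uniq // => x y; rewrite !mem_iota !add0n.
  by move=> /= ltx lty; apply: letter_inj.
move=> y; rewrite mem_iota /= add0n; apply/mapP/idP => [[x]|lty].
  by rewrite mem_iota /= add0n => ltx ->; apply: letter_lt.
by have [x ltx <-] := letter_surj w lty; exists x; rewrite // mem_iota.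
Qed.

Lemma sort_letters c (v : seq nat) :
  perm_eq v (iota 0 c) -> sort <=%R (letters v) = letters (iota 0 c).
Proof.
move=> pv; have /perm_sortP e : perm_eq (letters v) (letters (iota 0 c)).
  exact: perm_map.
rewrite e; [|exact: le_total|exact: le_trans|exact: le_anti].
apply: sorted_sort; first exact: le_trans.
rewrite /letters sorted_map; apply: sub_sorted (iota_sorted 0 c) => x y /=.
by rewrite lez_nat.
Qed.

(** Without repetitions, the letter at [j] belongs to the prefix of length [d] just when [j < d], so
    the prefixes can be compared position by position. *)
Lemma smallest_firstP c (v : seq nat) d : perm_eq v (iota 0 c) -> (d <= c)%N ->
  reflect (forall j, (j < c)%N -> (j < d)%N = (nth 0%N v j < d)%N)
    (smallest_first (letters v) d).
Proof.
move=> pv led; have sv : size v = c by rewrite (perm_size pv) size_iota.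
have uv : uniq v by rewrite (perm_uniq pv) iota_uniq.
have mv x : (x \in v) = (x < c)%N by rewrite (perm_mem pv) mem_iota.
have mem_tk j : (j < c)%N -> (nth 0%N v j \in take d v) = (j < d)%N.
  move=> ltj; apply/idP/idP => [/(nthP 0%N)[i]|ltjd].
    rewrite size_take sv => lti; have ltid : (i < d)%N by move: lti; case: ifP; lia.
    by rewrite nth_take // => /eqP; rewrite nth_uniq ?sv //; lia.
  apply/(nthP 0%N); exists j; last by rewrite nth_take.
  by rewrite size_take sv; case: ifP; lia.
rewrite /smallest_first (sort_letters pv) /letters -!map_take take_iota (minn_idPl led).
have inj : injective (fun x => Posz x.+1) by move=> x y [].
apply: (iffP idP) => [/(perm_map_inj inj) pd j ltj|vd].
  by rewrite -mem_tk // (perm_mem pd) mem_iota.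
apply: perm_map; apply: uniq_perm; rewrite ?take_uniq ?iota_uniq // => x.
rewrite mem_iota /= add0n; have [ltxc|lecx] := ltnP x c; last first.
  rewrite [RHS]ltnNge (leq_trans led lecx); apply/negP => /mem_take.
  by rewrite mv; lia.
rewrite -mv in ltxc; have ltj : (index x v < c)%N by rewrite -sv index_mem.
by rewrite -{1}(nth_index 0%N ltxc) mem_tk // vd // nth_index.
Qed.

Lemma tail_size_lt (w : seq int) : reflect
  (exists d, (0 < d < size w)%N /\ smallest_first w d) (tail_size w < size w)%N.
Proof.
rewrite /tail_size; case: ex_minnP => d /andP[d_gt0 wd] mind.
apply: (iffP idP) => [ltd|[e [/andP[e_gt0 lte] we]]].
  by exists d; rewrite d_gt0.
by apply: leq_ltn_trans lte; apply: mind; rewrite e_gt0.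
Qed.

Lemma right_leaningP c (u : 'S_c) :
  reflect (exists2 d, (0 < d < c)%N & Rdec u d) (right_leaning (word u)).
Proof.
have sfP d : (d < c)%N -> reflect (Rdec u d) (smallest_first (word u) d).
  move=> ltd; rewrite wordE; have := smallest_firstP (perm_letters u) (ltnW ltd).
  move=> sf; apply: (iffP sf) => ud j ltj.
    by rewrite ud // (nth_map 0%N) ?size_iota // nth_iota.
  by rewrite ud // (nth_map 0%N) ?size_iota // nth_iota.
apply: (iffP (tail_size_lt _)); rewrite size_word => -[d].
  by move=> [dc /sfP ud]; exists d => //; apply: ud; lia.
by move=> dc ud; exists d; split=> //; apply/sfP => //; lia.
Qed.

Lemma left_leaningP c (u : 'S_c) :
  reflect (exists2 d, (0 < d < c)%N & Ldec u d) (left_leaning (word u)).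
Proof.
(* The first [c - d] letters of the reversal are those at positions from [d] on. *)
have sfP d : (0 < d < c)%N ->
    reflect (Ldec u d) (smallest_first (rev (word u)) (c - d)).
  move=> dc; rewrite wordE /letters -map_rev.
  have prev := perm_letters u; rewrite -perm_rev in prev.
  have := smallest_firstP prev (leq_subr d c).
  have nthr j : (j < c)%N ->
      nth 0%N (rev [seq letter u x | x <- iota 0 c]) j = letter u (c - j.+1).
    move=> ltj; rewrite nth_rev size_map size_iota //.
    rewrite (nth_map 0%N) ?size_iota; last lia.
    by rewrite nth_iota //; lia.
  move=> sf; apply: (iffP sf) => ud j ltj.
    have := ud (c - j.+1)%N ltac:(lia); rewrite nthr; last lia.
    by rewrite (_ : (c - (c - j.+1).+1 = j)%N); lia.
  by rewrite nthr // -ud; lia.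
rewrite /left_leaning -size_rev.
apply: (iffP (tail_size_lt _)); rewrite size_rev size_word => -[d].
  move=> [dc]; rewrite -[d](subKn (ltnW (proj2 (andP dc)))) => /sfP ud.
  by exists (c - d)%N; [|apply: ud]; lia.
by move=> dc ud; exists (c - d)%N; split; [lia|apply/sfP].
Qed.

(** The first decomposition puts the first letter below the last, the second puts it above. *)
Lemma Rdec_Ldec_disjoint c (u : 'S_c) d e :
  (0 < d < c)%N -> (0 < e < c)%N -> Rdec u d -> Ldec u e -> False.
Proof.
move=> dc ec ud ue; have := ud 0%N ltac:(lia); have := ue 0%N ltac:(lia).
by have := ud c.-1 ltac:(lia); have := ue c.-1 ltac:(lia); lia.
Qed.

Lemma LO_not_Rdec c (u : 'S_c) d :
  u \in L_ c :|: O_ c -> (0 < d < c)%N -> ~ Rdec u d.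
Proof.
move=> uLO dc ud; have uR : right_leaning (word u) by apply/right_leaningP; exists d.
move: uLO; rewrite !inE /omni_leaning uR orbF => /left_leaningP[e ec].
exact: Rdec_Ldec_disjoint dc ec ud.
Qed.

Lemma RO_not_Ldec c (u : 'S_c) d :
  u \in R_ c :|: O_ c -> (0 < d < c)%N -> ~ Ldec u d.
Proof.
move=> uRO dc ud; have uL : left_leaning (word u) by apply/left_leaningP; exists d.
move: uRO; rewrite !inE /omni_leaning uL andbF orbF => /right_leaningP[e ec ue].
exact: Rdec_Ldec_disjoint ec dc ue ud.
Qed.

Lemma forms_nth c (s : seq int) (u : 'S_c) : forms s u <->
  size s = c /\ exists k : int, forall j, (j < c)%N ->
    nth 0 s j = Posz (letter u j).+1 + k.
Proof.
split=> [[k ->]|[ss [k sk]]].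
  rewrite size_map size_word; split=> //; exists k => j ltj.
  by rewrite (nth_map 0) ?size_word // nth_word.
exists k; apply: (@eq_from_nth _ 0) => [|j]; first by rewrite size_map size_word.
by rewrite ss => ltj; rewrite sk // (nth_map 0) ?size_word // nth_word.
Qed.

(** * Rearrangements as flips *)

Section Bridge.
Variables (c n k : nat) (pat : bool -> 'I_k -> 'S_c) (P : {set {set 'S_c}}).
Hypothesis c_gt0 : (0 < c)%N.
Hypothesis defP : P = [set [set pat false i; pat true i] | i : 'I_k].

(** A rearrangement may keep its pattern, whence the case [w = w']. *)
Lemma P_rearrangement_flip (w w' : 'S_n) : P_rearrangement P w w' ->
  w = w' \/ exists q i s, flip pat q i s w w'.
Proof.
case=> A [AP [u [v [uA vA [x [t [t' [y [ew ew' ptt' fu fv]]]]]]]]].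
have /forms_nth[st [k0 tk]] := fu; have /forms_nth[st' [k1 tk']] := fv.
have sw : (size x + (c + size y) = n)%N by rewrite -(size_word w) ew !size_cat st.
(* The smallest letter determines the shift, so rearranged windows have equal shifts. *)
have lebnd (r r' : seq int) (z z' : 'S_c) (h h' : int) : size r = c -> size r' = c ->
    (forall j, (j < c)%N -> nth 0 r j = Posz (letter z j).+1 + h) ->
    (forall j, (j < c)%N -> nth 0 r' j = Posz (letter z' j).+1 + h') ->
    perm_eq r r' -> h' <= h.
  move=> sr sr' rh rh' prr'; have [j ltj ej] := letter_surj z c_gt0.
  have : nth 0 r j \in r' by rewrite -(perm_mem prr') mem_nth ?sr.
  by case/(nthP 0) => i; rewrite sr' => lti; rewrite rh // rh' // ej; lia.
have ek : k0 = k1.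
  apply: le_anti; rewrite (lebnd _ _ _ _ _ _ st' st tk' tk ptt').
  by rewrite perm_sym in ptt'; rewrite (lebnd _ _ _ _ _ _ st st' tk tk' ptt').
have wt j : (j < c)%N -> Posz (letter w (size x + j)).+1 = nth 0 t j.
  move=> ltj; rewrite -nth_word; last lia.
  by rewrite ew nth_cat ltnNge leq_addr /= addKn nth_cat st ltj.
have wt' j : (j < c)%N -> Posz (letter w' (size x + j)).+1 = nth 0 t' j.
  move=> ltj; rewrite -nth_word; last lia.
  by rewrite ew' nth_cat ltnNge leq_addr /= addKn nth_cat st' ltj.
have out z : (z < n)%N -> ~~ (size x <= z < size x + c)%N -> letter w z = letter w' z.
  move=> ltz nz; have : nth 0 (word w) z = nth 0 (word w') z.
    rewrite ew ew' !nth_cat st st'; have [//|lexz] := ltnP z (size x).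
    by have -> : (z - size x < c)%N = false by lia.
  by rewrite !nth_word //; case.
(* The smallest letter of the window is [1 + k0] and at least 1. *)
have [v0 ev0] : exists v0 : nat, k0 = v0.
  have [j ltj ej] := letter_surj u c_gt0.
  have := wt j ltj; rewrite tk // ej => e.
    by exists `|k0|%N; rewrite gez0_abs //; lia.
have hw j : (j < c)%N -> letter w (size x + j) = (v0 + letter u j)%N.
  by move=> ltj; have := wt j ltj; rewrite tk // ev0; lia.
have hw' j : (j < c)%N -> letter w' (size x + j) = (v0 + letter v j)%N.
  by move=> ltj; have := wt' j ltj; rewrite tk' // -ek ev0; lia.
have [i [s [s' [eu ev]]]] : exists i s s', u = pat s i /\ v = pat s' i.
  move: AP uA vA; rewrite defP => /imsetP[i _ ->]; rewrite !inE.
  by move=> /orP[/eqP->|/eqP->] /orP[/eqP->|/eqP->]; exists i;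
    [exists false, false|exists false, true|exists true, false|exists true, true].
have [es|/negPf es] := eqVneq s s'.
  left; apply: letter_ext => z ltz.
  have [qz|nqz] := boolP (size x <= z < size x + c)%N; last exact: out.
  rewrite (_ : z = size x + (z - size x))%N; last lia.
  by rewrite hw ?hw' ?eu ?ev ?es //; lia.
have {}es : s' = ~~ s by case: s s' es {eu ev} => [] [].
right; exists (size x), i, s, v0; split=> //; split; rewrite -?eu -?es -?ev //; lia.
Qed.

Lemma flip_P_rearrangement q i s (w w' : 'S_n) :
  flip pat q i s w w' -> P_rearrangement P w w'.
Proof.
move=> [v [[leqn h] [_ h'] e]].
exists [set pat false i; pat true i]; split.
  by rewrite defP; apply/imsetP; exists i.
exists (pat s i), (pat (~~ s) i); split; try by case: (s); rewrite !inE eqxx ?orbT.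
have shape (z : 'S_n) : word z =
    take q (word z) ++ take c (drop q (word z)) ++ drop (q + c) (word z).
  by rewrite addnC -drop_drop !cat_take_drop.
have nthd (z : 'S_n) j : (j < c)%N ->
    nth 0 (take c (drop q (word z))) j = Posz (letter z (q + j)).+1.
  by move=> ltj; rewrite nth_take // nth_drop nth_word //; lia.
have sd (z : 'S_n) : size (take c (drop q (word z))) = c.
  by rewrite size_take size_drop size_word; case: ifP; lia.
have f : forms (take c (drop q (word w))) (pat s i).
  apply/forms_nth; split=> //; exists (Posz v) => j ltj.
  by rewrite nthd // h //; lia.
have f' : forms (take c (drop q (word w'))) (pat (~~ s) i).
  apply/forms_nth; split=> //; exists (Posz v) => j ltj.
  by rewrite nthd // h' //; lia.
exists (take q (word w)), (take c (drop q (word w))), (take c (drop q (word w'))),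
  (drop (q + c) (word w)); split=> //.
- have -> : take q (word w) = take q (word w').
    apply: (@eq_from_nth _ 0); rewrite !size_take !size_word // => j.
    move=> lt; have ltj : (j < q)%N by move: lt; case: ifP; lia.
    by rewrite !nth_take // !nth_word ?e //; lia.
  have -> : drop (q + c) (word w) = drop (q + c) (word w').
    apply: (@eq_from_nth _ 0); rewrite !size_drop !size_word // => j ltj.
    by rewrite !nth_drop !nth_word ?e //; lia.
  exact: shape.
have rep (z : 'S_n) u :
    (forall j, (j < c)%N -> letter z (q + j) = (v + letter u j)%N) ->
    take c (drop q (word z)) =
    [seq Posz (v + x).+1 | x <- [seq letter (u : 'S_c) x | x <- iota 0 c]].
  move=> hz; apply: (@eq_from_nth _ 0); rewrite sd ?size_map ?size_iota // => j ltj.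
  by rewrite nthd // -map_comp (nth_map 0%N) ?size_iota //= nth_iota // hz.
rewrite (rep _ _ h) (rep _ _ h'); apply: perm_map.
by apply: perm_trans (perm_letters _) _; rewrite perm_sym perm_letters.
Qed.

(** A hit starts at most at [n - c], so the bound [n.+1 - c] excludes no flip. *)
Lemma P_equivE (w w' : 'S_n) : P_equiv P w w' = eqv pat (n.+1 - c) w w'.
Proof.
apply/idP/idP; apply: connect_sub => {w w'} w w'.
  case/asboolP/P_rearrangement_flip => [->|[q [i [s f]]]]; first exact: connect0.
  have [v [[leqn _] _ _]] := f.
  by apply: flip_eqv f; lia.
case/stepP => q [i [s [_ f]]]; apply/connect1/asboolP.
exact: flip_P_rearrangement f.
Qed.

Lemma card_P_classes : #|P_classes n P| = nclasses pat n (n.+1 - c).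
Proof.
congr #|pred_of_set _|; apply: eq_imset => w.
by apply/setP=> w'; rewrite !inE P_equivE.
Qed.

End Bridge.

Theorem theorem3p2 (c n : nat) (c_gt0 : (0 < c)%N) (le_cn : (c <= n)%N)
    (k : nat) (a b : 'I_k -> 'S_c)
    (aLO : forall i, a i \in L_ c :|: O_ c)
    (bRO : forall i, b i \in R_ c :|: O_ c)
    (neq_ab : forall i j, a i != b j)
    (D : {set 'S_c}) (P : {set {set 'S_c}})
    (defP : P = [set [set a i; b i] | i : 'I_k])
    (cardP : #|P| = k)
    (partP : partition P D) :
  (#|P_classes n P|%:R : rat) =
  \sum_(0 <= j < n.+1 | (c * j <= n)%N)
    ((-1) ^+ j * ((n - c * j + j)`! ^ 2)%N%:R * k%:R ^+ j)
      / ((j`!)%N%:R * ((n - c * j)`!)%N%:R).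
Proof.
pose pat (s : bool) i := if s then b i else a i.
(* As [P] has [k] parts, the indexing repeats none; disjointness of the parts then makes all
   patterns distinct. *)
have inj : injective (fun i => [set a i; b i]).
  have /eqP := cardP; rewrite defP -[X in _ == X]card_ord => /imset_injP ij.
  by move=> i j; apply: ij.
have common i j u : u \in [set a i; b i] -> u \in [set a j; b j] -> i = j.
  move=> ui uj; apply: inj; have /and3P[_ tiP _] := partP.
  have inP l : [set a l; b l] \in P by rewrite defP; apply/imsetP; exists l.
  by rewrite -(def_pblock tiP (inP i) ui) (def_pblock tiP (inP j) uj).
have pat_inj s i s' i' : pat s i = pat s' i' -> s = s' /\ i = i'.
  move=> e; have ss' : s = s'.
    by case: s s' e => [] [] //= e; have := neq_ab; [move/(_ i' i)|move/(_ i i')];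
      rewrite e eqxx.
  split=> //; apply: (common _ _ (pat s i)); last rewrite e.
    by rewrite /pat; case: (s); rewrite !inE eqxx ?orbT.
  by rewrite /pat; case: (s'); rewrite !inE eqxx ?orbT.
have patT i d : (0 < d < c)%N -> ~ Ldec (pat true i) d by apply: RO_not_Ldec.
have patF i d : (0 < d < c)%N -> ~ Rdec (pat false i) d by apply: LO_not_Rdec.
have -> : #|P_classes n P| = nclasses pat n (n.+1 - c) by apply: card_P_classes.
rewrite (@closed_form c k (nclasses pat) c_gt0 _ _ _ _ n); first last.
- by right; lia.
- by lia.
- by move=> m n' p; apply: nclasses_rec.
- exact: nclasses0.
rewrite [RHS]big_mkcond big_mkord; apply: eq_bigr => j _.
by apply: spread_factorial; rewrite c_gt0.
Qed.
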